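(* Let $0<\alpha<1$, let $a<b$ be real, and let $f\in L^1(a,b)$. Then, for $a<t<b$, the ABR fractional derivative of $f$ can be expressed as $$ {}^{ABR}D^{\alpha}_{a+}f(t)=\frac{B(\alpha)}{1-\alpha}\sum_{n=0}^{\infty}\Big(\frac{-\alpha}{1-\alpha}\Big)^n\frac{\mathrm{d}}{\mathrm{d}t}\Big({}^{RL}I^{\alpha n+1}_{a+}f(t)\Big), $$ or equivalently, provided that the composition of Riemann--Liouville differintegrals of $f$ works as it should (i.e. $\frac{\mathrm{d}}{\mathrm{d}t}\,{}^{RL}I^{\alpha n+1}_{a+}f(t)={}^{RL}I^{\alpha n}_{a+}f(t)$ for all $n\ge 0$), as $$ {}^{ABR}D^{\alpha}_{a+}f(t)=\frac{B(\alpha)}{1-\alpha}\sum_{n=0}^{\infty}\Big(\frac{-\alpha}{1-\alpha}\Big)^n\,{}^{RL}I^{\alpha n}_{a+}f(t), $$ each series converging locally uniformly in $t$.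
   Context: The Mittag-Leffler function is $E_\alpha(x)=\sum_{n=0}^\infty \frac{x^n}{\Gamma(\alpha n+1)}$. $B$ is a fixed normalisation function with real, strictly positive values and $B(0)=B(1)=1$. For $0<\alpha<1$, $a<t<b$ and $f\in L^1(a,b)$, the ABR fractional derivative is $$ {}^{ABR}D^{\alpha}_{a+}f(t)=\frac{B(\alpha)}{1-\alpha}\frac{\mathrm{d}}{\mathrm{d}t}\int_a^t f(x)E_\alpha\Big(\frac{-\alpha}{1-\alpha}(t-x)^{\alpha}\Big)\,\mathrm{d}x. $$ The Riemann--Liouville fractional integral of order $\nu>0$ is ${}^{RL}I^{\nu}_{a+}f(t)=\frac{1}{\Gamma(\nu)}\int_a^t(t-\tau)^{\nu-1}f(\tau)\,\mathrm{d}\tau$, and ${}^{RL}I^0_{a+}f=f$.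
   Formalization: Since d/dt of the integral of an L^1 function need not exist at every point, the first formula is stated at each t in (a,b) where all the derivatives of RL I^{αn+1} f exist, which is shown to be almost every t, rather than at every a<t<b. *)

(* Defs.v *)
From HB Require Import structures.
From mathcomp Require Export all_boot all_order all_algebra.
From mathcomp Require Export all_classical all_reals all_analysis.
Export Order.TTheory GRing.Theory Num.Theory.
Export numFieldNormedType.Exports.

Set Implicit Arguments.
Unset Strict Implicit.
Unset Printing Implicit Defensive.

Local Open Scope classical_set_scope.
Local Open Scope ring_scope.

(* Euler's integral; meaningful for z > 0, the only arguments used below. *)
Definition Gamma (R : realType) (z : R) : R :=
  \int[lebesgue_measure]_(s in `]0, +oo[) (s `^ (z - 1) * expR (- s)).

Definition mittag_leffler (R : realType) (alpha x : R) : R :=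
  limn (series (fun n : nat => x ^+ n / Gamma (alpha * n%:R + 1))).

(* Meaningful for nu >= 0.  The value is real: at a point where the integrand
   is not Lebesgue integrable (for f in L^1, possible only if 0 < nu < 1, on a null set) it
   is a default value. *)
Definition RLint (R : realType) (a nu : R) (f : R -> R) (t : R) : R :=
  if nu == 0 then f t
  else (Gamma nu)^-1 *
       \int[lebesgue_measure]_(x in `]a, t[) ((t - x) `^ (nu - 1) * f x).

Definition ML_convolution (R : realType) (alpha a : R) (f : R -> R) (t : R) : R :=
  \int[lebesgue_measure]_(x in `]a, t[)
    (f x * mittag_leffler alpha (- alpha / (1 - alpha) * (t - x) `^ alpha)).

(* [derive1] is a total operator: this is the ABR derivative at [t] when
   [derivable (ML_convolution alpha a f) t 1]. *)
Definition ABR (R : realType) (B : R -> R) (alpha a : R) (f : R -> R) (t : R) : R :=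
  B alpha / (1 - alpha) * derive1 (ML_convolution alpha a f) t.

Definition normalisation (R : realType) (B : R -> R) : Prop :=
  [/\ forall x, 0 <= x <= 1 -> 0 < B x, B 0 = 1 & B 1 = 1].

Definition locally_uniformly_summable (R : realType) (I : set R)
    (u : nat -> R -> R) : Prop :=
  forall t0, I t0 -> exists2 U : set R, nbhs t0 U &
    {uniform U, (fun N t => series (u ^~ t) N) @ \oo -->
                (fun t => limn (series (u ^~ t)))}.

(* Main.v *)
Require Import Defs.
From mathcomp Require Import measurable_realfun ring lra.

Set Implicit Arguments.
Unset Strict Implicit.
Unset Printing Implicit Defensive.

Local Open Scope classical_set_scope.
Local Open Scope ring_scope.

(** The Mittag-Leffler kernel is the sum of the powers
    [c ^+ n * (t - x) `^ (alpha * n) / Gamma (alpha * n + 1)] with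
    [c = - alpha / (1 - alpha)], so integrating it against [f] term by term
    gives the series of the [c ^+ n * I^(alpha n + 1) f (t)]; dominated
    convergence justifies this ([cvg_series_mittag_leffler_convolution]).
    The theorem is the differentiation of that series in [t].

    As [f] is only integrable, the terms with [alpha * n < 1] may fail to be
    differentiable at some points, and nothing is known there beyond what the
    theorem assumes at the point considered.  There are finitely many such
    terms.  When [alpha * n >= 1] the term is Lipschitz on [`]a, b[] with
    constant [|c| ^ n * alpha n * (b - a) `^ (alpha n - 1) * norm f
    / Gamma (alpha n + 1)] ([power_convolution_lipschitz]), and because Gamma
    grows faster than every exponential these constants are dominated by a
    geometric sequence ([inv_Gamma_geometric]).  Summable Lipschitz constants
    dominate the difference quotients, so that the series can be
    differentiated at one point ([derivable_series]), and they bound the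
    derivatives, which gives the local uniform convergence
    ([locally_uniformly_summableM]).

    Both the Lipschitz bound and the almost everywhere differentiability of the
    terms come from one identity, the integral of [I^nu f] being [I^(nu+1) f]
    up to normalisation.  It is Fubini's theorem
    ([integral_power_convolution]); Lebesgue's differentiation theorem then
    applies to the integrable function [I^nu f]. *)

(** * Series of functions with a summable majorant *)

(** The rank [m] leaves finitely many terms of [v] arbitrary; past it the tail of
    [L] bounds that of [v], by the triangle inequality on the partial sums. *)
Lemma series_tail (R : realType) (v L : R ^nat) (m : nat) :
  cvgn (series L) -> (forall n, (m <= n)%N -> `|v n| <= L n) ->
  cvgn (series v) /\
  forall N, (m <= N)%N ->
    `|series v N - limn (series v)| <= limn (series L) - series L N.
Proof.
move=> cL vL.
have vLs p q : (m <= p)%N ->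
    `|\sum_(p <= k < q) v k| <= `|\sum_(p <= k < q) L k|.
  move=> mp; apply: le_trans (ler_norm_sum _ _ _) (le_trans _ (ler_norm _)).
  by apply: ler_sum_nat => k /andP[pk _]; exact/vL/(leq_trans mp).
have cv : cvgn (series v).
  apply/cauchy_cvgP/cauchy_seriesP => e e0.
  have /cauchy_cvgP/cauchy_seriesP/(_ e e0) Le := cL.
  have mle : \forall n \near (\oo, \oo), (m <= n.1)%N.
    by exists ([set k | (m <= k)%N], setT) => [|[p q] []//]; split;
      [exact: nbhs_infty_ge|exact: filterT].
  by apply: filterS2 mle Le => -[p q] /= mp; exact/le_lt_trans/vLs.
split=> // N mN.
have cLN : (fun M => series L M - series L N) @ \oo -->
    limn (series L) - series L N by apply: cvgB => //; exact: cvg_cst.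
have cvN : (fun M => `|series v N - series v M|) @ \oo -->
    `|series v N - limn (series v)|.
  by apply: cvg_norm; apply: cvgB => //; exact: cvg_cst.
rewrite -(cvg_lim _ cLN)// -(cvg_lim _ cvN)//; apply: ler_lim.
- exact: cvgP cvN.
- exact: cvgP cLN.
- near=> M; rewrite distrC !sub_series_geq//; try by near: M; exact: nbhs_infty_ge.
  apply: le_trans (ler_norm_sum _ _ _) _.
  by apply: ler_sum_nat => k /andP[Nk _]; exact/vL/(leq_trans mN).
Unshelve. all: by end_near. Qed.

(** Weierstrass's M-test.  The first [m] terms are arbitrary functions: they
    cancel in the difference between the sum and a partial sum. *)
Lemma locally_uniformly_summableM (R : realType) (I : set R)
    (u : nat -> R -> R) (L : R ^nat) (m : nat) :
  open I -> cvgn (series L) ->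
  (forall n t, (m <= n)%N -> I t -> `|u n t| <= L n) ->
  locally_uniformly_summable I u.
Proof.
move=> oI cL uL t0 It0; exists I; first exact: open_nbhs_nbhs.
move=> P /uniform_nbhs[E [entE EP]].
have [e /= e0 eE] := entE.
have := cL => /cvgrPdist_lt/(_ e e0) Le.
near=> N; apply: EP => t It; apply: eE => /=.
have [_ /(_ N)] := series_tail cL (fun n mn => uL n t mn It).
rewrite distrC => /(_ _)/le_lt_trans; apply; first by near: N; exact: nbhs_infty_ge.
by apply: le_lt_trans (ler_norm _) _; near: N.
Unshelve. all: by end_near. Qed.

Lemma cvg_derive1 (R : realType) (f : R -> R) (t l : R) :
  (fun h => h^-1 *: (f (h + t) - f t)) @ 0^' --> l ->
  derivable f t 1 /\ derive1 f t = l.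
Proof.
move=> fl; split; last exact: cvg_lim fl.
apply/cvg_ex; exists l; apply: cvg_trans fl; apply: near_eq_cvg.
by near=> h; rewrite /= [h *: 1]mulr1.
Unshelve. all: by end_near. Qed.

(** Where the difference quotient diverges, [derive1] takes the default value
    [0], which satisfies the bound as well. *)
Lemma norm_derive1_le (R : realType) (f : R -> R) (t L : R) : 0 <= L ->
  (\forall s \near t, `|f s - f t| <= L * `|s - t|) -> `|derive1 f t| <= L.
Proof.
move=> L0 fL; rewrite /derive1; set q := (fun h => _).
have [cq|/dvgP->] := pselect (cvg (q @ 0^')); last by rewrite normr0.
rewrite -lim_norm//; apply: limr_le; first exact: is_cvg_norm.
have near_shift : \forall h \near (0 : R), `|f (h + t) - f t| <= L * `|h + t - t|.
  have : (fun h => h + t) @ (0 : R) --> t.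
    by rewrite -[X in _ --> X]add0r; apply: cvgD => //; exact: cvg_cst.
  by move=> /(_ _ fL).
near=> h.
have h0 : h != 0 by near: h; exact: nbhs_dnbhs_neq.
rewrite /q normrM normfV ler_pdivrMl ?normr_gt0// mulrC -[X in _ * `|X|](addrK t).
by near: h; exact: nbhs_dnbhs near_shift.
Unshelve. all: by end_near. Qed.

(** Termwise differentiation at a single point [t], by dominated convergence of
    the series of difference quotients: the Lipschitz constants [L n] dominate
    these quotients uniformly in the increment. *)
Lemma derivable_series (R : realType) (u : nat -> R -> R) (F : R -> R)
    (L : R ^nat) (m : nat) (t : R) :
  cvgn (series L) -> (forall n, (m <= n)%N -> 0 <= L n) ->
  (forall n, derivable (u n) t 1) ->
  (\forall s \near t, series (u ^~ s) @ \oo --> F s) ->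
  (\forall s \near t, forall n, (m <= n)%N ->
     `|u n s - u n t| <= L n * `|s - t|) ->
  derivable F t 1 /\
  derive1 F t = limn (series (fun n => derive1 (u n) t)).
Proof.
move=> cL L0 du uF uL; apply: cvg_derive1.
set d := fun n => derive1 (u n) t; set S := limn _.
have dL n : (m <= n)%N -> `|d n| <= L n.
  move=> mn; apply: norm_derive1_le; first exact: L0.
  by apply: filterS uL => s /(_ n mn).
have [_ dtail] := series_tail cL dL.
have shift (P : set R) : nbhs t P -> \forall h \near 0^', P (h + t).
  move=> Pt; apply: nbhs_dnbhs.
  have : (fun h => h + t) @ (0 : R) --> t.
    by rewrite -[X in _ --> X]add0r; apply: cvgD => //; exact: cvg_cst.
  by move=> /(_ _ Pt).
pose q n h := h^-1 *: (u n (h + t) - u n t).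
have qd n : q n @ 0^' --> d n.
  have := du n; rewrite /derivable /d /derive1 /q.
  have -> : (fun h : R => h^-1 *: (u n (h *: 1 + t) - u n t)) = q n.
    by apply/funext => h; rewrite /q [h *: 1]mulr1.
  by [].
have qdN N : (fun h => series (q ^~ h) N) @ 0^' --> series d N.
  by rewrite /series /=; apply: (cvg_big add_continuous) => // n _; exact: qd.
apply/cvgrPdist_le => e e0.
have e30 : 0 < e / 3 by rewrite divr_gt0.
have /cvgrPdist_le/(_ _ e30) Le := cL.
(* Past rank [N] both the quotients and the derivatives contribute at most
   [e / 3]; the first [N] quotients converge as a finite sum. *)
have [N [mN LN]] : exists N, (m <= N)%N /\ limn (series L) - series L N <= e / 3.
  near \oo => N; exists N; split; first by near: N; exact: nbhs_infty_ge.
  by apply: le_trans (ler_norm _) _; near: N.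
have /cvgrPdist_le/(_ _ e30) qdNe := qdN N.
near=> h.
have h0 : h != 0 by near: h; exact: nbhs_dnbhs_neq.
have qL n : (m <= n)%N -> `|q n h| <= L n.
  move=> mn; rewrite /q normrM normfV ler_pdivrMl ?normr_gt0// mulrC.
  rewrite -[X in _ * `|X|](addrK t); move: (n) (mn); near: h; exact: shift uL.
have [_ /(_ N mN)] := series_tail cL qL.
have -> : limn (series (q ^~ h)) = h^-1 *: (F (h + t) - F t).
  apply: cvg_lim => //.
  have -> : series (q ^~ h) =
      (fun N => h^-1 *: (series (u ^~ (h + t)) N - series (u ^~ t) N)).
    by apply/funext => M; rewrite /series /= /q -sumrB scaler_sumr.
  apply: cvgZr; apply: cvgB; last exact: (nbhs_singleton uF).
  near: h; exact: shift uF.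
have := dtail N mN.
have : `|series d N - series (q ^~ h) N| <= e / 3 by near: h.
set a := series _ N; set b := series _ N; set c := h^-1 *: _.
move=> ab aS bc.
have -> : S - c = (S - a) + (a - b) + (b - c) by ring.
have -> : e = e / 3 + e / 3 + e / 3 by field.
apply: le_trans (ler_normD _ _) _; apply: lerD; last exact: le_trans bc LN.
apply: le_trans (ler_normD _ _) _; apply: lerD => //.
by rewrite distrC; exact: le_trans aS LN.
Unshelve. all: by end_near. Qed.

(** * The integral of a shifted power *)

Lemma is_derive_powR_shift (R : realType) (a nu x : R) : a < x ->
  is_derive x (1 : R) (fun y : R => (y - a) `^ nu) (nu * (x - a) `^ (nu - 1)).
Proof.
move=> ax.
have dsub : is_derive x (1 : R) (fun y : R => y - a) 1.
  by apply: is_derive_eq; rewrite subr0.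
have dpow : is_derive (x - a) (1 : R) ((@powR R) ^~ nu) (nu * (x - a) `^ (nu - 1)).
  by apply: is_derive1_powR; rewrite subr_gt0.
have := @is_derive1_comp R ((@powR R) ^~ nu) (fun y => y - a) x _ _ dpow dsub.
by rewrite mulr1.
Qed.

Lemma continuous_powR_shift (R : realType) (a nu x : R) : a < x ->
  {for x, continuous (fun y : R => (y - a) `^ nu)}.
Proof.
move=> /(is_derive_powR_shift nu)[dp _].
by apply: differentiable_continuous; exact/derivable1_diffP.
Qed.

Lemma integral_powR_shift_cc (R : realType) (a c b nu : R) :
  a < c -> c < b -> nu != 0 ->
  (\int[lebesgue_measure]_(x in `[c, b]) ((x - a) `^ (nu - 1))%:E =
   ((b - a) `^ nu / nu - (c - a) `^ nu / nu)%:E)%E.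
Proof.
move=> ac cb nu0.
have dF x : a < x ->
    is_derive x (1 : R) (fun y : R => (y - a) `^ nu / nu) ((x - a) `^ (nu - 1)).
  move=> ax; have dp := is_derive_powR_shift nu ax.
  by apply: is_derive_eq; rewrite /GRing.scale /= mulr0 add0r mulrA mulVf// mul1r.
have cF x : a < x -> {for x, continuous (fun y : R => (y - a) `^ nu / nu)}.
  by case/dF => dp _; apply: differentiable_continuous; exact/derivable1_diffP.
rewrite (@continuous_FTC2 _ _ (fun y => (y - a) `^ nu / nu)) ?EFinB//.
- apply: continuous_in_subspaceT => x; rewrite inE/= in_itv/= => /andP[cx _].
  exact/continuous_powR_shift/(lt_le_trans ac).
- split.
  + move=> x; rewrite in_itv/= => /andP[cx _].
    by case: (dF x (lt_trans ac cx)).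
  + exact/cvg_at_right_filter/cF.
  + exact/cvg_at_left_filter/cF/(lt_trans ac).
- move=> x; rewrite in_itv/= => /andP[cx _].
  by rewrite derive1E; case: (dF x (lt_trans ac cx)).
Qed.

(** For [nu < 1] the integrand is unbounded near [a], so the integral is the
    increasing limit of those over [`[a + n.+1^-1, b[], where the antiderivative
    [(x - a) `^ nu / nu] is smooth. *)
Lemma integral_powR_shift (R : realType) (a b nu : R) : a < b -> 0 < nu ->
  (\int[lebesgue_measure]_(x in `]a, b[) ((x - a) `^ (nu - 1))%:E =
   ((b - a) `^ nu / nu)%:E)%E.
Proof.
move=> ab nu0.
pose p (x : R) := (x - a) `^ (nu - 1).
have mp (D : set R) : measurable_fun D (EFin \o p).
  apply/measurable_EFinP.
  apply: (measurableT_comp (measurable_powR _)).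
  exact: measurable_funB.
rewrite itv_open_bnd_bigcup.
pose f := EFin \o p.
pose F n := `[a + n.+1%:R^-1, b[%classic.
change (\int[lebesgue_measure]_(x in \bigcup_n F n) f x = ((b - a) `^ nu / nu)%:E)%E.
have cF : (\int[lebesgue_measure]_(x in F n) f x)%E @[n --> \oo] -->
    (\int[lebesgue_measure]_(x in \bigcup_n F n) f x)%E.
  apply: ge0_nondecreasing_set_cvg_integral => //.
  - move=> n k nk; rewrite subsetEset; apply: subset_itvr.
    by rewrite bnd_simp lerD2l lef_pV2 ?posrE// ler_nat.
  - by move=> n; exact: measurable_itv.
  - by move=> n; exact: mp.
  - by move=> n x _; rewrite lee_fin powR_ge0.
have {}cF' : (\int[lebesgue_measure]_(x in F n) f x)%E @[n --> \oo] -->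
    ((b - a) `^ nu / nu)%:E.
  have pc : (fun n : nat => (b - a) `^ nu / nu - n.+1%:R^-1 `^ nu / nu) @ \oo -->
      (b - a) `^ nu / nu.
    suff : (fun n : nat => (b - a) `^ nu / nu - n.+1%:R^-1 `^ nu / nu) @ \oo -->
        (b - a) `^ nu / nu - 0 / nu by rewrite mul0r subr0.
    apply: cvgB; first exact: cvg_cst.
    apply: cvgMr_tmp; have /cvg_at_rightP pc := powR_cvg0 nu0.
    by apply: (pc (fun n => n.+1%:R^-1)); split => [n|]; [rewrite invr_gt0|exact: cvg_harmonic].
  have intF : \forall n \near \oo, (\int[lebesgue_measure]_(x in F n) f x)%E =
      ((b - a) `^ nu / nu - n.+1%:R^-1 `^ nu / nu)%:E.
    near=> n; rewrite /F /f.
    have nab : a + n.+1%:R^-1 < b.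
      rewrite -ltrBrDl; near: n.
      by apply: (cvgr_lt 0 cvg_harmonic); rewrite subr_gt0.
    have an : a < a + n.+1%:R^-1 by rewrite ltrDl invr_gt0.
    rewrite integral_itv_bndo_bndc; last exact: mp.
    by rewrite /= integral_powR_shift_cc// ?gt_eqF// (addrC a) addrK.
  apply: cvg_EFin; first by apply: filterS intF => n ->.
  apply: cvg_trans pc; apply: near_eq_cvg.
  by apply: filterS intF => n; rewrite /comp => ->.
exact: (cvg_unique _ cF cF').
Unshelve. all: by end_near. Qed.

(** * Fubini's theorem for fractional integrals *)

(** Up to the factor [1 / Gamma (nu + 1)], this is the Riemann-Liouville integral
    of order [nu + 1]. *)
Definition power_convolution (R : realType) (a nu : R) (f : R -> R) (t : R) : R :=
  \int[lebesgue_measure]_(x in `]a, t[) ((t - x) `^ nu * f x).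

Lemma integrable_powR_mul (R : realType) (a t nu : R) (f : R -> R) : 0 <= nu ->
  lebesgue_measure.-integrable `]a, t[ (fun x => (f x)%:E) ->
  lebesgue_measure.-integrable `]a, t[ (fun x => ((t - x) `^ nu * f x)%:E).
Proof.
move=> nu0 intf; pose h (x : R) := (t - x) `^ nu.
have -> : (fun x => (h x * f x)%:E) = ((EFin \o h) \* (EFin \o f))%E by [].
apply: integrableMr => //.
- apply: measurable_funTS; apply: (measurableT_comp (measurable_powR _)).
  exact: measurable_funB.
- exists ((t - a) `^ nu); split; first exact: num_real.
  move=> M tM x /=; rewrite in_itv/= => /andP[ax xt]; apply: le_trans (ltW tM).
  rewrite ger0_norm ?powR_ge0//.
  by apply: ge0_ler_powR; rewrite ?nnegrE//; lra.
Qed.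

Section fractional_fubini.
Context (R : realType) (a b nu : R) (f : R -> R).
Hypotheses (nu_gt0 : 0 < nu) (ab : a < b).
Hypothesis intf : lebesgue_measure.-integrable `]a, b[ (fun x => (f x)%:E).

Let mu := @lebesgue_measure R.
Let D : set R := `]a, b[.
Let p : R -> R := (@powR R ^~ (nu - 1)) \_ `]0, +oo[.
(** The integrand of the iterated integral, extended by zero outside the triangle
    [a < x < s < b], with [z = (s, x)]. *)
Let K (z : measurableTypeR R * measurableTypeR R) : R :=
  (f \_ D) z.2 * (p (z.1 - z.2) * \1_D z.1).

Let p_ge0 y : 0 <= p y.
Proof. by rewrite /p patchE; case: ifP => // _; exact: powR_ge0. Qed.

Let measurable_p : measurable_fun setT p.
Proof.
apply/(measurable_restrictT _ _).1; first exact: measurable_itv.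
by apply: measurable_funTS; exact: measurable_powR.
Qed.

Let measurable_fD : measurable_fun setT (f \_ D).
Proof.
apply/(measurable_restrictT _ _).1; first exact: measurable_itv.
by apply/measurable_EFinP; case/integrableP: intf.
Qed.

Let measurable_K : measurable_fun setT K.
Proof.
apply: measurable_funM.
  by apply: (measurableT_comp measurable_fD); exact: measurable_snd.
apply: measurable_funM.
  apply: (measurableT_comp measurable_p).
  by apply: measurable_funB; [exact: measurable_fst|exact: measurable_snd].
by apply: (measurableT_comp (measurable_indic _)) => //; exact: measurable_itv.
Qed.

Let kernel_restrict x : D x ->
  (fun s => (p (s - x) * \1_D s)%:E) =
  (fun s => ((s - x) `^ (nu - 1))%:E) \_ `]x, b[.
Proof.
rewrite /D /= in_itv/= => /andP[ax xb]; apply/funext => s.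
rewrite !patchE /p patchE indicE !mem_setE !in_itv/= andbT subr_gt0.
have [xs|sx] := ltP x s; last by rewrite mul0r.
by rewrite (lt_trans ax xs)/=; case: ifP; rewrite ?mulr1 ?mulr0.
Qed.

Let integral_kernel x : D x ->
  (\int[mu]_s (p (s - x) * \1_D s)%:E = ((b - x) `^ nu / nu)%:E)%E.
Proof.
move=> Dx; rewrite kernel_restrict// -integral_mkcond integral_powR_shift//.
by move: Dx; rewrite /D /= in_itv/= => /andP[].
Qed.

Let integral_absK x :
  (\int[mu]_s `|(K (s, x))%:E| = `|(f \_ D) x|%:E * ((b - x) `^ nu / nu)%:E)%E.
Proof.
have [Dx|nDx] := pselect (D x); last first.
  rewrite patchE memNset// normr0 mul0e; apply: integral0_eq => s _.
  by rewrite /K /= patchE memNset// mul0r normr0.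
rewrite -(integral_kernel Dx) -ge0_integralZl//; last 2 first.
- apply/measurable_EFinP; apply: measurable_funM.
    apply: (measurableT_comp measurable_p); exact: measurable_funB.
  by apply: measurable_indic; exact: measurable_itv.
- by move=> s _; rewrite lee_fin mulr_ge0.
apply: eq_integral => s _; rewrite /K /= -EFinM normrM; congr (_ * _)%:E.
by rewrite ger0_norm// mulr_ge0.
Qed.

(** Tonelli: the inner integral in [s] of the kernel is at most
    [(b - a) `^ nu / nu], uniformly in [x], which leaves the norm of [f]. *)
Let integrable_K : (mu \x mu)%E.-integrable setT (EFin \o K).
Proof.
apply/integrable21ltyP; first exact/measurable_EFinP.
have := intf => /integrableP[mf foo].
apply: (@le_lt_trans _ _ (((b - a) `^ nu / nu)%:E * \int[mu]_(x in D) `|(f x)%:E|)%E).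
  rewrite -ge0_integralZl//; last 2 first.
  - exact: measurableT_comp.
  - by rewrite lee_fin divr_ge0 ?powR_ge0 ?ltW.
  rewrite [leRHS]integral_mkcond; apply: ge0_le_integral => //.
  - by move=> x _; exact: integral_ge0.
  - apply: (measurable_fun_fubini_tonelli_G (fun z => `|(K z)%:E|%E)) => //.
    by apply: measurableT_comp => //; exact/measurable_EFinP.
  - apply/(measurable_restrictT _ _).1; first exact: measurable_itv.
    by apply: measurable_funeM; exact: measurableT_comp.
  move=> x _; rewrite integral_absK !patchE; case: ifPn => [|_]; last by rewrite normr0 mul0e.
  rewrite inE /D /= in_itv/= => /andP[ax xb].
  rewrite muleC -!EFinM lee_fin ler_wpM2r// ler_pM2r ?invr_gt0//.
  have [bx ba bxa] : [/\ 0 <= b - x, 0 <= b - a & b - x <= b - a].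
    by rewrite !subr_ge0 lerD2l lerN2 !ltW.
  by apply: ge0_ler_powR; rewrite ?nnegrE// ltW.
  exact: measurable_itv.
by rewrite lte_mul_pinfty// lee_fin divr_ge0 ?powR_ge0 ?ltW.
Qed.

Let fubini_GE s : D s -> (\int[mu]_x (K (s, x))%:E =
   \int[mu]_(x in `]a, s[) ((s - x) `^ (nu - 1) * f x)%:E)%E.
Proof.
move=> Ds; rewrite [RHS]integral_mkcond; apply: eq_integral => x _.
rewrite /K /= !patchE /p patchE indicE (mem_set Ds) mulr1.
move: Ds; rewrite /D /= !mem_setE !in_itv/= andbT subr_gt0 => /andP[as_ sb].
have [xs|sx] := ltP x s; last by rewrite andbF mulr0.
by rewrite (lt_trans xs sb) !andbT; case: ifP; rewrite ?mul0r// mulrC.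
Qed.

Let fubini_GE0 s : ~ D s -> (\int[mu]_x (K (s, x))%:E = 0)%E.
Proof.
move=> nDs; apply: integral0_eq => x _.
by rewrite /K /= indicE memNset// !mulr0.
Qed.

Let G s : \bar R := (\int[mu]_x (K (s, x))%:E)%E.

Let integrable_G : mu.-integrable setT G.
Proof. exact: (integrable_fubini_F integrable_K). Qed.

Let fineG s : D s -> fine (G s) = power_convolution a (nu - 1) f s.
Proof. by move=> Ds; rewrite /G fubini_GE. Qed.

Lemma integrable_power_convolution :
  mu.-integrable `]a, b[ (EFin \o power_convolution a (nu - 1) f).
Proof.
have mD : measurable (D : set (measurableTypeR R)) by exact: measurable_itv.
have iG : mu.-integrable D G.
  by apply: integrableS integrable_G => //; exact: measurableT.
apply: (eq_integrable _ (EFin \o (fine \o G))) => //.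
  by move=> s; rewrite inE => Ds /=; rewrite fineG.
apply: le_integrable iG => //.
  apply/measurable_EFinP; apply: measurable_funTS.
  apply: measurableT_comp; first exact: fine_measurable.
  exact: measurable_int integrable_G.
by move=> s _ /=; case: (G s) => //=; exact: leey.
Qed.

(** The semigroup property of fractional integrals for one integration of order
    one: exchanging the integrals, each [f x] is multiplied by
    [\int[mu]_(s in `]x, b[) (s - x) `^ (nu - 1) = (b - x) `^ nu / nu]. *)
Lemma integral_power_convolution :
  \int[mu]_(s in `]a, b[) power_convolution a (nu - 1) f s =
  nu^-1 * power_convolution a nu f b.
Proof.
have mD : measurable (D : set (measurableTypeR R)) by exact: measurable_itv.
have iG : mu.-integrable D G.
  by apply: integrableS integrable_G => //; exact: measurableT.
rewrite /power_convolution -RintegralZl//; last first.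
  by apply: integrable_powR_mul => //; exact: ltW.
congr fine.
transitivity (\int[mu]_(s in D) G s)%E.
  apply: ae_eq_integral => //.
  - exact: measurable_int integrable_power_convolution.
  - exact: measurable_int iG.
  have := integrable_ae mD iG; apply: filterS => s /= finG Ds.
  by rewrite -[LHS]/((power_convolution a (nu - 1) f s)%:E) -(fineG Ds) fineK// finG.
transitivity (\int[mu]_s G s)%E.
  rewrite integral_mkcond; apply: eq_integral => s _; rewrite patchE.
  by case: ifPn => //; rewrite notin_setE => nDs; rewrite /G fubini_GE0.
transitivity (\int[mu]_x \int[mu]_s (K (s, x))%:E)%E; first exact: Fubini integrable_K.
rewrite [RHS]integral_mkcond; apply: eq_integral => x _; rewrite patchE.
case: ifPn => [|xD]; last first.
  have nDx : ~ D x by move: xD; rewrite notin_setE.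
  by apply: integral0_eq => s _; rewrite /K /= patchE memNset// mul0r.
rewrite inE => Dx; pose k s := (p (s - x) * \1_D s)%:E.
have mk : measurable_fun setT k.
  apply/measurable_EFinP; apply: measurable_funM.
    apply: (measurableT_comp measurable_p); exact: measurable_funB.
  by apply: measurable_indic; exact: measurable_itv.
transitivity ((f x)%:E * \int[mu]_s k s)%E.
  have ik : mu.-integrable setT k.
    apply/integrableP; split=> //.
    under eq_integral do rewrite gee0_abs ?lee_fin ?mulr_ge0//.
    by rewrite integral_kernel// ltry.
  rewrite -integralZl//.
  by apply: eq_integral => s _; rewrite /K /k /= patchE (mem_set Dx).
by rewrite integral_kernel// -EFinM; congr EFin; ring.
Qed.

End fractional_fubini.

(** * Regularity of fractional integrals *)

Section power_convolution_regularity.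
Context (R : realType) (a b : R) (f : R -> R).
Hypothesis ab : a < b.
Hypothesis intf : lebesgue_measure.-integrable `]a, b[ (fun x => (f x)%:E).

Let mu := @lebesgue_measure R.

Lemma integrable_itv_prefix (g : R -> R) (t : R) : t <= b ->
  mu.-integrable `]a, b[ (EFin \o g) -> mu.-integrable `]a, t[ (EFin \o g).
Proof.
move=> tb; apply: integrableS; try exact: measurable_itv.
by apply: subset_itvl; rewrite bnd_simp.
Qed.

(** The Fubini identity with its upper end point [t] varying: it presents
    [power_convolution a nu f] as an indefinite integral. *)
Lemma power_convolutionE (nu t : R) : 0 < nu -> a < t <= b ->
  power_convolution a nu f t =
  nu * \int[mu]_(s in `]a, t[) power_convolution a (nu - 1) f s.
Proof.
move=> nu0 /andP[at_ tb].
rewrite integral_power_convolution//; last exact: integrable_itv_prefix intf.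
by rewrite mulrA divff ?mul1r// gt_eqF.
Qed.

Lemma ae_derivable_Rintegral (g : R -> R) :
  mu.-integrable `]a, b[ (EFin \o g) ->
  {ae mu, forall t : R, a < t < b ->
    derivable (fun s => \int[mu]_(x in `]a, s[) g x) t 1}.
Proof.
move=> intg; pose gD := g \_ `]a, b[.
have igD : mu.-integrable setT (EFin \o gD).
  by rewrite /gD -restrict_EFin -integrable_mkcond.
have locg : locally_integrable setT gD by apply: integrable_locally.
have := @FTC1 R gD (BRight a) _ locg.
have igDy y : mu.-integrable [set` Interval (BRight a) (BRight y)] (EFin \o gD).
  by apply: integrableS igD.
move=> /(_ igDy); apply: filterS; first exact: (ae_filter_ringOfSetsType mu).
move=> t FTC /andP[at_ tb].
have [dF _] := FTC at_.
apply: near_eq_derivable dF => //.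
near=> s.
have ats : a < s by near: s; exact: lt_nbhsr.
have sbt : s < b by near: s; exact: lt_nbhsl.
rewrite Rintegral_itv_bndo_bndc; last exact: integrable_itv_prefix (ltW sbt) intg.
apply: eq_Rintegral => x; rewrite inE/= in_itv/= => /andP[ax xs].
by rewrite /gD patchE mem_set//= in_itv/= ax (le_lt_trans xs).
Unshelve. all: by end_near. Qed.

Lemma power_convolution0 (t : R) :
  power_convolution a 0 f t = \int[mu]_(x in `]a, t[) f x.
Proof. by apply: eq_Rintegral => x _; rewrite powRr0 mul1r. Qed.

(** By Lebesgue's differentiation theorem, an indefinite integral of an
    integrable function is differentiable almost everywhere. *)
Lemma ae_derivable_power_convolution (nu : R) : 0 <= nu ->
  {ae mu, forall t : R, a < t < b -> derivable (power_convolution a nu f) t 1}.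
Proof.
rewrite le_eqVlt => /predU1P[<-|nu0].
  have -> : power_convolution a 0 f = (fun t => \int[mu]_(x in `]a, t[) f x).
    exact/funext/power_convolution0.
  exact: ae_derivable_Rintegral.
have := ae_derivable_Rintegral (integrable_power_convolution nu0 ab intf).
apply: filterS; first exact: (ae_filter_ringOfSetsType mu).
move=> t + /[dup] tab /andP[at_ tb] => /(_ tab) dt.
have := @derivableZ _ _ _ _ nu _ _ dt; apply: near_eq_derivable => //.
near=> s; rewrite power_convolutionE//.
by apply/andP; split; [|apply: ltW]; near: s; [exact: lt_nbhsr|exact: lt_nbhsl].
Unshelve. all: by end_near. Qed.

Lemma norm_power_convolution_le (nu t : R) : 0 <= nu -> a < t <= b ->
  `|power_convolution a nu f t| <=
    (b - a) `^ nu * \int[mu]_(x in `]a, b[) `|f x|.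
Proof.
move=> nu0 /andP[at_ tb].
have intft := integrable_itv_prefix tb intf.
have intn (c : R) : mu.-integrable `]a, c[ (EFin \o f) ->
    mu.-integrable `]a, c[ (EFin \o (fun x => `|f x|)).
  by move=> ic; apply: integrable_norm ic.
apply: le_trans (le_normr_Rintegral _ _) _ => //.
  exact: integrable_powR_mul.
apply: (@le_trans _ _ (\int[mu]_(x in `]a, t[) ((b - a) `^ nu * `|f x|))).
  apply: le_Rintegral => //.
  - by apply: integrable_norm; exact: integrable_powR_mul.
  - pose fn x := `|f x|.
    have -> : EFin \o (fun x => (b - a) `^ nu * fn x) =
        (fun x => ((b - a) `^ nu)%:E * (EFin \o fn) x)%E by [].
    by apply: integrableZl => //; exact: intn.
  - move=> x; rewrite /= in_itv/= => /andP[ax xt].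
    rewrite normrM ler_wpM2r// ger0_norm ?powR_ge0//.
    by apply: ge0_ler_powR; rewrite ?nnegrE//; lra.
rewrite RintegralZl//; last exact: intn.
rewrite ler_wpM2l ?powR_ge0//; apply: fine_le.
- exact: integrable_fin_num (intn _ intft).
- exact: integrable_fin_num (intn _ intf).
apply: ge0_subset_integral => //.
- by case/integrableP: (intn _ intf).
- by apply: subset_itvl; rewrite bnd_simp.
Qed.

(** For [1 <= nu] the function integrated in [power_convolutionE] is bounded,
    because its kernel has the nonnegative exponent [nu - 1]. *)
Lemma power_convolution_lipschitz (nu s t : R) : 1 <= nu -> a < s < b -> a < t < b ->
  `|power_convolution a nu f s - power_convolution a nu f t| <=
    nu * (b - a) `^ (nu - 1) * (\int[mu]_(x in `]a, b[) `|f x|) * `|s - t|.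
Proof.
move=> nu1; have [->|sNt] := eqVneq s t; first by rewrite !subrr normr0 mulr0.
wlog st : s t sNt / s < t => [wlg sab tab|/andP[as_ sb] /andP[at_ tb]].
  have [st|ts|eqst] := ltgtP s t; first exact: wlg; last by rewrite eqst eqxx in sNt.
  by rewrite distrC (distrC s); apply: wlg; rewrite // eq_sym.
have nu0 : 0 < nu by exact: lt_le_trans nu1.
set g := power_convolution a (nu - 1) f.
pose C := (b - a) `^ (nu - 1) * (\int[mu]_(x in `]a, b[) `|f x|).
have ig := integrable_power_convolution nu0 ab intf.
have igt := integrable_itv_prefix (ltW tb) ig.
have [sab tab] : a < s <= b /\ a < t <= b by rewrite as_ at_ !ltW.
rewrite distrC !power_convolutionE// -mulrBr.
rewrite [X in _ - X]Rintegral_itv_bndo_bndc; last exact: integrable_itv_prefix (ltW sb) ig.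
rewrite (@Rintegral_itvB _ _ _ _ s igt) ?bnd_simp// ?(ltW as_)//.
rewrite normrM (gtr0_norm nu0) -!mulrA ler_pM2l// mulrA -/C.
have igst : mu.-integrable `]s, t[ (EFin \o g).
  apply: integrableS igt => //.
  by apply: subset_itvr; rewrite bnd_simp ltW.
apply: le_trans (le_normr_Rintegral _ igst) _ => //.
have mst : mu `]s, t[ = (t - s)%:E by rewrite /mu lebesgue_measure_itv/= lte_fin st.
apply: (@le_trans _ _ (\int[mu]_(x in `]s, t[) C)); last first.
  by rewrite Rintegral_cst// [X in fine X]mst/= distrC gtr0_norm// subr_gt0.
apply: le_Rintegral => //; first exact: integrable_norm.
  apply/integrableP; split; first exact: measurable_cst.
  rewrite integral_cst//; rewrite [X in (_ * X)%E]mst -EFinM; exact: ltry.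
move=> x; rewrite /= in_itv/= => /andP[sx xt].
apply: norm_power_convolution_le; first by rewrite subr_ge0.
by rewrite (lt_trans as_ sx) ltW// (lt_trans xt tb).
Qed.

End power_convolution_regularity.

(** * Lower bounds for Gamma *)

Lemma Gamma_ge0 (R : realType) (z : R) : 0 <= Gamma z.
Proof. by apply: Rintegral_ge0 => s _; rewrite mulr_ge0 ?powR_ge0 ?expR_ge0. Qed.

(** Euler's integral is at least its part over [`]M, M + 1[], where the integrand
    is at least [M `^ (z - 1) * expR (- (M + 1))].  The proof splits on whether
    the integral is finite; were it infinite, [Gamma z] and its inverse would
    both be the default value [0]. *)
Lemma inv_Gamma_le (R : realType) (M z : R) : 0 < M -> 1 <= z ->
  (Gamma z)^-1 <= expR (M + 1) * M `^ (1 - z).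
Proof.
move=> M0 z1; pose g (s : R) := s `^ (z - 1) * expR (- s).
have g0 s : 0 <= g s by rewrite mulr_ge0 ?powR_ge0 ?expR_ge0.
have mg (D : set R) : measurable_fun D g.
  apply: measurable_funTS; apply: measurable_funM; first exact: measurable_powR.
  by apply: measurableT_comp => //; exact: measurableT_comp.
have [N NE] : exists N, N = M + 1 by exists (M + 1).
pose m := M `^ (z - 1) * expR (- (M + 1)).
have m0 : 0 < m by rewrite mulr_gt0 ?powR_gt0 ?expR_gt0.
have mI : (m%:E <= \int[lebesgue_measure]_(s in `]0%R, +oo[) (g s)%:E)%E.
  apply: (@le_trans _ _ (\int[lebesgue_measure]_(s in `]M, N[) (g s)%:E)%E).
    apply: (@le_trans _ _ (\int[lebesgue_measure]_(s in `]M, N[) m%:E)%E).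
      rewrite integral_cst//= lebesgue_measure_itv/= NE lte_fin ltrDl ltr01.
      by rewrite -EFinB -EFinM addrAC subrr add0r mulr1.
    apply: ge0_le_integral => //.
    - by move=> s _; rewrite lee_fin ltW.
    - apply/measurable_EFinP; apply: mg.
    - move=> s; rewrite NE /= in_itv/= lee_fin => /andP[Ms sM].
      apply: ler_pM; rewrite ?powR_ge0 ?expR_ge0//; last first.
        by rewrite ler_expR lerN2 ltW.
      by apply: ge0_ler_powR; rewrite ?nnegrE; lra.
  apply: ge0_subset_integral => //; first by apply/measurable_EFinP; apply: mg.
    by move=> s _; rewrite lee_fin.
  move=> s; rewrite /= !in_itv/= andbT => /andP[Ms _]; exact: lt_trans Ms.
have minv : expR (M + 1) * M `^ (1 - z) = m^-1.
  by rewrite /m invfM expRN invrK -powRN opprB mulrC.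
rewrite minv /Gamma /Rintegral.
move: mI; rewrite -/g.
case: (\int[_]_(s in _) _)%E => [r|_|//]; last by rewrite /= invr0 invr_ge0 ltW.
by rewrite lee_fin /= => mr; rewrite lef_pV2// posrE (lt_le_trans m0).
Qed.

(** Since [M] is free in [inv_Gamma_le], [Gamma] beats every exponential.  The
    factor [n.+1] is there for the Lipschitz constants, where the exponent
    [alpha * n] comes out as a factor. *)
Lemma inv_Gamma_geometric (R : realType) (alpha x : R) : 0 < alpha -> 0 <= x ->
  exists2 C : R, 0 <= C & forall (n : nat) (z : R), 1 <= z -> alpha * n%:R <= z ->
    n.+1%:R * x ^+ n / Gamma z <= geometric C 2^-1 n.
Proof.
(* [M] is chosen with [M `^ alpha = q >= 4 * x]: one factor [2^-1] of
   [4^-1 = 2^-1 * 2^-1] absorbs [n.+1 <= 2 ^+ n], the other remains.  Adding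
   [1] ensures [M >= 1]. *)
move=> alpha0 x0; pose q := 4 * x + 1; pose M := q `^ alpha^-1.
have q1 : 1 <= q by rewrite /q; lra.
have q0 : 0 < q by lra.
have M0 : 0 < M by exact: powR_gt0.
have M1 : 1 <= M.
  by rewrite -(powRr0 q); apply: ler_powR => //; rewrite invr_ge0 ltW.
have Malpha : M `^ alpha = q.
  by rewrite /M -powRrM mulVf ?gt_eqF// powRr1// ltW.
exists (expR (M + 1) * M) => [|n z z1 nz].
  by rewrite mulr_ge0 ?expR_ge0// ltW.
have Mz : M `^ (1 - z) <= M / q ^+ n.
  apply: (@le_trans _ _ (M `^ (1 - alpha * n%:R))).
    by apply: ler_powR => //; rewrite lerD2l lerN2.
  rewrite powRD; last by rewrite (gt_eqF M0) implybT.
  by rewrite (powRr1 (ltW M0)) powRN powRrM Malpha powR_mulrn ?(ltW q0).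
have n2 : n.+1%:R <= 2 ^+ n :> R by rewrite -natrX ler_nat ltn_expl.
have xq : x ^+ n / q ^+ n <= 4^-1 ^+ n.
  rewrite -exprVn -exprMn; apply: lerXn2r; rewrite ?nnegrE//.
    by rewrite divr_ge0// ltW.
  by rewrite ler_pdivrMr// /q; lra.
have half : 2^-1 ^+ n = 2 ^+ n * 4^-1 ^+ n :> R.
  by rewrite -exprMn; congr (_ ^+ _); field.
rewrite /= half.
have xn0 : 0 <= x ^+ n by exact: exprn_ge0.
apply: (@le_trans _ _ (2 ^+ n * x ^+ n * (expR (M + 1) * (M / q ^+ n)))).
  apply: ler_pM.
  - by rewrite mulr_ge0.
  - by rewrite invr_ge0 Gamma_ge0.
  - by rewrite ler_wpM2r.
  - by apply: le_trans (inv_Gamma_le M0 z1) _; rewrite ler_wpM2l ?expR_ge0.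
have -> : 2 ^+ n * x ^+ n * (expR (M + 1) * (M / q ^+ n)) =
  expR (M + 1) * M * (2 ^+ n * (x ^+ n / q ^+ n)) by ring.
by rewrite ler_wpM2l ?mulr_ge0 ?expR_ge0 ?(ltW M0)// ler_wpM2l// exprn_ge0.
Qed.

(** * Termwise integration of the Mittag-Leffler kernel *)

Lemma mittag_leffler_term (R : realType) (alpha c y : R) (n : nat) : 0 <= y ->
  (c * y `^ alpha) ^+ n / Gamma (alpha * n%:R + 1) =
  c ^+ n / Gamma (alpha * n%:R + 1) * y `^ (alpha * n%:R).
Proof.
move=> y0; rewrite exprMn powRrM powR_mulrn ?powR_ge0//.
by rewrite mulrAC.
Qed.

Lemma mittag_leffler_term_le (R : realType) (alpha x : R) : 0 < alpha -> 0 <= x ->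
  exists2 C : R, 0 <= C & forall (n : nat) (z : R), `|z| <= x ->
    `|z ^+ n / Gamma (alpha * n%:R + 1)| <= geometric C 2^-1 n.
Proof.
move=> alpha0 x0; have [C C0 CP] := inv_Gamma_geometric alpha0 x0.
exists C => // n z zx; apply: le_trans (CP n (alpha * n%:R + 1) _ _).
- rewrite normrM normfV normrX (ger0_norm (Gamma_ge0 _)).
  rewrite ler_wpM2r ?invr_ge0 ?Gamma_ge0//.
  apply: (@le_trans _ _ (x ^+ n)); first by apply: lerXn2r; rewrite ?nnegrE.
  by rewrite ler_peMl ?exprn_ge0// ler1n.
- by rewrite lerDr mulr_ge0 ?(ltW alpha0).
- by rewrite lerDl.
Qed.

Lemma cvg_series_mittag_leffler (R : realType) (alpha z : R) : 0 < alpha ->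
  series (fun n => z ^+ n / Gamma (alpha * n%:R + 1)) @ \oo -->
  mittag_leffler alpha z.
Proof.
move=> alpha0; have [C C0 CP] := mittag_leffler_term_le alpha0 (normr_ge0 z).
have half1 : `|2^-1 : R| < 1 by rewrite ger0_norm// invf_lt1// ltr1n.
by have [] := series_tail (m := 0) (is_cvg_geometric_series (a := C) half1)
  (fun n _ => CP n z (lexx _)).
Qed.

Section mittag_leffler_convolution.
Context (R : realType) (alpha a t c : R) (f : R -> R).
Hypotheses (alpha_gt0 : 0 < alpha) (at_ : a < t).
Hypothesis intf : lebesgue_measure.-integrable `]a, t[ (fun x => (f x)%:E).

Let mu := @lebesgue_measure R.
Let D : set (measurableTypeR R) := `]a, t[.
Let e (n : nat) (x : R) : R :=
  (c * (t - x) `^ alpha) ^+ n / Gamma (alpha * n%:R + 1).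

Let term_integral n : mu.-integrable D (EFin \o (fun x => f x * e n x)) /\
  \int[mu]_(x in D) (f x * e n x) =
  c ^+ n / Gamma (alpha * n%:R + 1) * power_convolution a (alpha * n%:R) f t.
Proof.
have mD : measurable D by exact: measurable_itv.
have an0 : 0 <= alpha * n%:R by rewrite mulr_ge0// ltW.
have ip := integrable_powR_mul an0 intf.
pose k := c ^+ n / Gamma (alpha * n%:R + 1).
have eE : {in D, forall x, f x * e n x = k * ((t - x) `^ (alpha * n%:R) * f x)}.
  move=> x; rewrite inE /D /= in_itv/= => /andP[_ xt].
  by rewrite /e mittag_leffler_term ?subr_ge0 ?(ltW xt)// mulrC mulrA.
split.
  pose h x := (t - x) `^ (alpha * n%:R) * f x.
  apply: (eq_integrable mD (fun x => k%:E * (EFin \o h) x)%E).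
    by move=> x xD; rewrite /= eE.
  exact: integrableZl.
by rewrite (eq_Rintegral mu eE) RintegralZl.
Qed.

Let series_integral N :
  mu.-integrable D (EFin \o (fun x => f x * series (e ^~ x) N)) /\
  \int[mu]_(x in D) (f x * series (e ^~ x) N) =
  series (fun n => c ^+ n / Gamma (alpha * n%:R + 1) *
                   power_convolution a (alpha * n%:R) f t) N.
Proof.
have mD : measurable D by exact: measurable_itv.
elim: N => [|N [iN IHN]].
  have -> : (fun x => f x * series (e ^~ x) 0) = cst 0.
    by apply/funext => x; rewrite /series /= big_geq// mulr0.
  split; first exact: integrable0.
  by rewrite Rintegral_cst// mul0r /series /= big_geq.
have [iNe eN] := term_integral N.
have -> : (fun x => f x * series (e ^~ x) N.+1) =
    (fun x => f x * series (e ^~ x) N + f x * e N x).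
  by apply/funext => x; rewrite seriesSr mulrDr.
split; last by rewrite RintegralD// IHN eN seriesSr.
exact: (integrableD mD iN iNe).
Qed.

(** Integration of the Mittag-Leffler series term by term; the partial sums are
    dominated by [|f|] times the sum of a geometric series, as the argument
    [c * (t - x) `^ alpha] is bounded on [`]a, t[]. *)
Lemma cvg_series_mittag_leffler_convolution :
  series (fun n => c ^+ n / Gamma (alpha * n%:R + 1) *
                   power_convolution a (alpha * n%:R) f t) @ \oo -->
  \int[lebesgue_measure]_(x in `]a, t[)
    (f x * mittag_leffler alpha (c * (t - x) `^ alpha)).
Proof.
have mD : measurable D by exact: measurable_itv.
pose x0 := `|c| * (t - a) `^ alpha.
have x00 : 0 <= x0 by rewrite mulr_ge0 ?powR_ge0.
have [C C0 CP] := mittag_leffler_term_le alpha_gt0 x00.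
have zx (x : R) : D x -> `|c * (t - x) `^ alpha| <= x0.
  rewrite /D /= in_itv/= => /andP[ax xt].
  have [tx ta txa] : [/\ 0 <= t - x, 0 <= t - a & t - x <= t - a].
    by rewrite !subr_ge0 lerD2l lerN2 !ltW.
  rewrite normrM (ger0_norm (powR_ge0 _ _)) ler_wpM2l//.
  by apply: ge0_ler_powR; rewrite ?nnegrE// ltW.
have half1 : `|2^-1 : R| < 1 by rewrite ger0_norm// invf_lt1// ltr1n.
have cg := is_cvg_geometric_series (a := C) half1.
have g0 n : 0 <= geometric C 2^-1 n by rewrite geometric_ge0.
set F := fun x => f x * mittag_leffler alpha (c * (t - x) `^ alpha).
pose G := limn (series (geometric C 2^-1)).
pose F_ N x := f x * series (e ^~ x) N.
have F_F x : F_ ^~ x @ \oo --> F x.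
  by apply: cvgMl_tmp; exact: cvg_series_mittag_leffler.
have mF_ N : measurable_fun D (F_ N).
  by apply/measurable_EFinP; case/integrableP: (series_integral N).1.
have mF : measurable_fun D F by exact: (measurable_fun_cvg mF_).
have eC x n : D x -> `|e n x| <= geometric C 2^-1 n by move=> Dx; exact/CP/zx.
have dom x N : D x -> (`|(F_ N x)%:E| <= G%:E * `|(f x)%:E|)%E.
  move=> Dx; rewrite lee_fin normrM mulrC ler_wpM2r//.
  apply: le_trans (ler_norm_sum _ _ _) _.
  apply: le_trans (nondecreasing_cvgn_le _ cg N); last exact: nondecreasing_series.
  by apply: ler_sum => n _; exact: eC.
have [iF _ IF] : [/\ mu.-integrable D (EFin \o F),
    (\int[mu]_(x in D) `|(F_ N x)%:E - (F x)%:E|)%E @[N --> \oo] --> 0%E &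
    (\int[mu]_(x in D) (F_ N x)%:E)%E @[N --> \oo] -->
    (\int[mu]_(x in D) (F x)%:E)%E].
  apply: (@dominated_convergence _ _ R mu D mD (fun N => EFin \o F_ N) _
    (fun x => G%:E * `|(f x)%:E|)%E).
  - by move=> N; exact/measurable_EFinP.
  - exact/measurable_EFinP.
  - by apply: aeW => x Dx; apply: cvg_EFin; [exact: nearW|exact: F_F].
  - by apply: integrableZl => //; exact: integrable_abse.
  - by apply: aeW => x N Dx; exact: dom.
rewrite (eq_cvg _ _ (fun N => esym (series_integral N).2)).
apply: (@fine_cvg _ _ _ _ (fun N => \int[mu]_(x in D) (F_ N x)%:E)%E).
by rewrite fineK//; exact: integrable_fin_num.
Qed.

End mittag_leffler_convolution.

(** * The series of differintegrals *)

Lemma RLint_power_convolution (R : realType) (a nu : R) (f : R -> R) : 0 < nu ->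
  RLint a nu f = fun t => (Gamma nu)^-1 * power_convolution a (nu - 1) f t.
Proof. by move=> nu0; apply/funext => t; rewrite /RLint gt_eqF. Qed.

(** Only finitely many of the orders [alpha * n] lie below [1], the threshold
    above which the fractional integrals are Lipschitz. *)
Lemma exists_order_ge1 (R : realType) (alpha : R) : 0 < alpha ->
  exists m : nat, forall n, (m <= n)%N -> 1 <= alpha * n%:R.
Proof.
move=> alpha0; exists (Num.bound alpha^-1) => n mn.
rewrite -ler_pdivrMl// mulr1.
have := archi_boundP (ltW (_ : 0 < alpha^-1)); rewrite invr_gt0 => /(_ alpha0)/ltW.
by move=> /le_trans; apply; rewrite ler_nat.
Qed.

Section differintegral_series.
Context (R : realType) (alpha a b c : R) (f : R -> R).
Hypotheses (alpha_gt0 : 0 < alpha) (ab : a < b).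
Hypothesis intf : lebesgue_measure.-integrable `]a, b[ (fun x => (f x)%:E).

Let mu := @lebesgue_measure R.
Let normf := \int[mu]_(x in `]a, b[) `|f x|.

Let normf_ge0 : 0 <= normf. Proof. exact: Rintegral_ge0. Qed.

Let order_gt0 n : 0 < alpha * n%:R + 1.
Proof. by rewrite ltr_wpDl// mulr_ge0// ltW. Qed.

Lemma RLint_succE n :
  RLint a (alpha * n%:R + 1) f =
  (fun t => (Gamma (alpha * n%:R + 1))^-1 * power_convolution a (alpha * n%:R) f t).
Proof. by rewrite RLint_power_convolution// addrK. Qed.

Lemma ae_derivable_RLint :
  {ae mu, forall t : R, a < t < b ->
    forall n, derivable (RLint a (alpha * n%:R + 1) f) t 1}.
Proof.
have : {ae mu, forall t : R, forall n, a < t < b ->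
    derivable (power_convolution a (alpha * n%:R) f) t 1}.
  apply: ae_foralln => n; apply: ae_derivable_power_convolution => //.
  by rewrite mulr_ge0// ltW.
apply: filterS; first exact: (ae_filter_ringOfSetsType mu).
move=> t dt tab n; rewrite RLint_succE.
exact: (@derivableZ _ _ _ _ _ _ _ (dt n tab)).
Qed.

Let powR_ba n : (b - a) `^ (alpha * n%:R - 1) = ((b - a) `^ alpha) ^+ n / (b - a).
Proof.
have ba : 0 < b - a by rewrite subr_gt0.
rewrite powRB ?(gt_eqF ba) ?implybT// powRr1 ?(ltW ba)// powRrM powR_mulrn//.
exact: powR_ge0.
Qed.

Let majorant := `|c| * (b - a) `^ alpha.

Let lipschitz_const n :=
  (Gamma (alpha * n%:R + 1))^-1 *
  (alpha * n%:R * (b - a) `^ (alpha * n%:R - 1) * normf).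

Let lipschitz_const_ge0 n : 0 <= lipschitz_const n.
Proof.
by rewrite /lipschitz_const !mulr_ge0 ?powR_ge0 ?invr_ge0 ?Gamma_ge0 ?(ltW alpha_gt0).
Qed.

Let RLint_lipschitz n s t : 1 <= alpha * n%:R -> a < s < b -> a < t < b ->
  `|RLint a (alpha * n%:R + 1) f s - RLint a (alpha * n%:R + 1) f t| <=
  lipschitz_const n * `|s - t|.
Proof.
move=> n1 sab tab; rewrite RLint_succE -mulrBr normrM.
rewrite ger0_norm ?invr_ge0 ?Gamma_ge0// /lipschitz_const -mulrA.
by rewrite ler_wpM2l ?invr_ge0 ?Gamma_ge0// power_convolution_lipschitz.
Qed.

(** With [majorant = |c| (b - a)^alpha], the [n]-th constant is
    [alpha * normf / (b - a)] times [n * majorant ^ n / Gamma (alpha n + 1)]. *)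
Let lipschitz_majorant : exists2 K : R, 0 <= K &
  forall n, `|c ^+ n| * lipschitz_const n <= geometric K 2^-1 n.
Proof.
have x0 : 0 <= majorant by rewrite mulr_ge0 ?powR_ge0.
have [C C0 CP] := inv_Gamma_geometric alpha_gt0 x0.
have k0 : 0 <= alpha * normf / (b - a).
  by rewrite divr_ge0 ?mulr_ge0 ?(ltW alpha_gt0)// subr_ge0 ltW.
exists (alpha * normf / (b - a) * C) => [|n]; first exact: mulr_ge0.
have -> : `|c ^+ n| * lipschitz_const n =
    alpha * normf / (b - a) * (n%:R * majorant ^+ n / Gamma (alpha * n%:R + 1)).
  by rewrite /lipschitz_const powR_ba /majorant exprMn normrX; ring.
rewrite /= -[leRHS]mulrA ler_wpM2l//.
apply: le_trans (CP n (alpha * n%:R + 1) _ _).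
- by rewrite ler_wpM2r ?invr_ge0 ?Gamma_ge0// ler_wpM2r ?exprn_ge0// ler_nat.
- by rewrite lerDr mulr_ge0 ?(ltW alpha_gt0).
- by rewrite lerDl.
Qed.

Let half1 : `|2^-1 : R| < 1.
Proof. by rewrite ger0_norm// invf_lt1// ltr1n. Qed.

Let open_ab : open (`]a, b[%classic : set R).
Proof. exact: interval_open. Qed.

Let near_ab t : a < t < b -> \forall s \near t, a < s < b.
Proof.
move=> /andP[at_ tb]; near=> s.
by apply/andP; split; near: s; [exact: lt_nbhsr|exact: lt_nbhsl].
Unshelve. all: by end_near. Qed.

Lemma locally_uniformly_summable_derive1_RLint :
  locally_uniformly_summable `]a, b[
    (fun n t => c ^+ n * derive1 (RLint a (alpha * n%:R + 1) f) t).
Proof.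
have [K K0 KP] := lipschitz_majorant.
have [m mP] := exists_order_ge1 alpha_gt0.
apply: (locally_uniformly_summableM open_ab (is_cvg_geometric_series (a := K) half1)
  (m := m)) => n t mn; rewrite /= in_itv/= => tab.
apply: le_trans (KP n); rewrite normrM ler_wpM2l//.
apply: norm_derive1_le => //; apply: filterS (near_ab tab) => s sab.
exact: RLint_lipschitz (mP _ mn) sab tab.
Qed.

Lemma locally_uniformly_summable_RLint :
  locally_uniformly_summable `]a, b[
    (fun n t => c ^+ n * RLint a (alpha * n%:R) f t).
Proof.
have x0 : 0 <= majorant by rewrite mulr_ge0 ?powR_ge0.
have [C C0 CP] := inv_Gamma_geometric alpha_gt0 x0.
have [m mP] := exists_order_ge1 alpha_gt0.
have k0 : 0 <= normf / (b - a) by rewrite divr_ge0// subr_ge0 ltW.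
apply: (locally_uniformly_summableM open_ab
  (is_cvg_geometric_series (a := normf / (b - a) * C) half1) (m := m)) => n t mn.
rewrite /= in_itv/= => /andP[at_ tb]; have n1 := mP _ mn.
rewrite RLint_power_convolution; last exact: lt_le_trans n1.
rewrite !normrM normfV (ger0_norm (Gamma_ge0 _)).
have pt : `|power_convolution a (alpha * n%:R - 1) f t| <=
    (b - a) `^ (alpha * n%:R - 1) * normf.
  by apply: norm_power_convolution_le; rewrite ?subr_ge0 ?at_ ?(ltW tb).
apply: (@le_trans _ _ (`|c ^+ n| * ((Gamma (alpha * n%:R))^-1 *
    ((b - a) `^ (alpha * n%:R - 1) * normf)))).
  by rewrite ler_wpM2l// ler_wpM2l ?invr_ge0 ?Gamma_ge0.
have -> : `|c ^+ n| * ((Gamma (alpha * n%:R))^-1 *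
    ((b - a) `^ (alpha * n%:R - 1) * normf)) =
    normf / (b - a) * (majorant ^+ n / Gamma (alpha * n%:R)).
  by rewrite powR_ba /majorant exprMn normrX; ring.
rewrite /= -[leRHS]mulrA ler_wpM2l//; apply: le_trans (CP n _ n1 (lexx _)).
rewrite ler_wpM2r ?invr_ge0 ?Gamma_ge0//.
by rewrite ler_peMl ?exprn_ge0// ler1n.
Qed.

(** [F] is the sum of the [c ^+ n * I^(alpha n + 1) f] near [t], and the terms of
    rank at least [m] have summable Lipschitz constants; the terms of lower rank
    enter through their derivatives at [t] only. *)
Lemma derive1_mittag_leffler_convolution (t : R) : a < t < b ->
  (forall n, derivable (RLint a (alpha * n%:R + 1) f) t 1) ->
  let F s := \int[lebesgue_measure]_(x in `]a, s[)
    (f x * mittag_leffler alpha (c * (s - x) `^ alpha)) in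
  derivable F t 1 /\
  derive1 F t =
  limn (series (fun n => c ^+ n * derive1 (RLint a (alpha * n%:R + 1) f) t)).
Proof.
move=> tab dRL F.
have [K K0 KP] := lipschitz_majorant.
have [m mP] := exists_order_ge1 alpha_gt0.
pose u n s := c ^+ n * RLint a (alpha * n%:R + 1) f s.
have du n : derivable (u n) t 1 /\
    derive1 (u n) t = c ^+ n * derive1 (RLint a (alpha * n%:R + 1) f) t.
  split; first exact: (@derivableZ _ _ _ _ _ _ _ (dRL n)).
  by rewrite !derive1E; exact: (@deriveZ _ _ _ _ (c ^+ n) _ _ (dRL n)).
have term s n : a < s < b -> u n s = c ^+ n / Gamma (alpha * n%:R + 1) *
    power_convolution a (alpha * n%:R) f s.
  by move=> sab; rewrite /u RLint_succE mulrA.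
have [//|n _|n|||dF ->] := @derivable_series R u F (geometric K 2^-1) m t.
- exact: is_cvg_geometric_series.
- by rewrite geometric_ge0.
- exact: (du n).1.
- apply: filterS (near_ab tab) => s sab.
  rewrite (eq_cvg _ _ (fun N => eq_bigr _ (fun n _ => term s n sab))).
  apply: cvg_series_mittag_leffler_convolution => //; first by case/andP: sab.
  by apply: integrable_itv_prefix intf; case/andP: sab => _ /ltW.
- apply: filterS (near_ab tab) => s sab n mn.
  rewrite -mulrBr normrM; apply: le_trans (ler_wpM2r (normr_ge0 _) (KP n)).
  by rewrite -mulrA ler_wpM2l//; exact: RLint_lipschitz (mP _ mn) sab tab.
- split=> //; congr (limn (series _)).
  by apply/funext => n; rewrite (du n).2.
Qed.

End differintegral_series.

Theorem theorem2p1 (R : realType) (B : R -> R) (alpha a b : R) (f : R -> R)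
    (hB : normalisation B) (halpha0 : 0 < alpha) (halpha1 : alpha < 1)
    (hab : a < b)
    (hf : lebesgue_measure.-integrable `]a, b[ (fun x => (f x)%:E)) :
  [/\ (* the termwise derivatives exist almost everywhere *)
      {ae lebesgue_measure, forall t : R, a < t < b ->
         forall n : nat, derivable (RLint a (alpha * n%:R + 1) f) t 1},
      (* wherever they exist, so does the ABR derivative, given by the series *)
      forall t : R, a < t < b ->
        (forall n : nat, derivable (RLint a (alpha * n%:R + 1) f) t 1) ->
        derivable (ML_convolution alpha a f) t 1 /\
        ABR B alpha a f t =
          B alpha / (1 - alpha) *
          limn (series (fun n : nat => (- alpha / (1 - alpha)) ^+ n *
                                 derive1 (RLint a (alpha * n%:R + 1) f) t)),
      locally_uniformly_summable `]a, b[
        (fun n t => (- alpha / (1 - alpha)) ^+ n *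
                    derive1 (RLint a (alpha * n%:R + 1) f) t),
      (* where the Riemann-Liouville differintegrals of f compose *)
      forall t : R, a < t < b ->
        (forall n : nat, derivable (RLint a (alpha * n%:R + 1) f) t 1 /\
           derive1 (RLint a (alpha * n%:R + 1) f) t = RLint a (alpha * n%:R) f t) ->
        derivable (ML_convolution alpha a f) t 1 /\
        ABR B alpha a f t =
          B alpha / (1 - alpha) *
          limn (series (fun n : nat => (- alpha / (1 - alpha)) ^+ n *
                                 RLint a (alpha * n%:R) f t))
    & locally_uniformly_summable `]a, b[
        (fun n t => (- alpha / (1 - alpha)) ^+ n *
                    RLint a (alpha * n%:R) f t)].
Proof.
have ABR_series t : a < t < b ->
    (forall n : nat, derivable (RLint a (alpha * n%:R + 1) f) t 1) ->
    derivable (ML_convolution alpha a f) t 1 /\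
    ABR B alpha a f t = B alpha / (1 - alpha) *
      limn (series (fun n : nat => (- alpha / (1 - alpha)) ^+ n *
                      derive1 (RLint a (alpha * n%:R + 1) f) t)).
  move=> tab dRL.
  have [dF F'E] := derive1_mittag_leffler_convolution
    (- alpha / (1 - alpha)) halpha0 hab hf tab dRL.
  by split; [exact: dF|rewrite /ABR -F'E].
split.
- exact: ae_derivable_RLint.
- exact: ABR_series.
- exact: locally_uniformly_summable_derive1_RLint.
- move=> t tab comp.
  have [dF ->] := ABR_series t tab (fun n => (comp n).1).
  split=> //; congr (_ * _); congr (limn (series _)).
  by apply/funext => n; rewrite (comp n).2.
- exact: locally_uniformly_summable_RLint.
Qed.
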